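(* Let $\ell\ge2$ and let $M=(m_{ij})_{1\le i<j\le\ell}$ be a tuple of non-negative integers such that $m_{ij}=0$ whenever $\{i,j\}\notin\{\{1,2\},\{2,3\},\dots,\{\ell-1,\ell\},\{\ell,1\}\}$. Then the graphic arrangement $\mathcal{A}_{Q_\ell(M)}$ is flag-accurate.
   Context: Let $\mathbb{K}$ be a field. For a simple graph $G$ with vertex set $\{v_1,\dots,v_n\}$, the graphic arrangement in $\mathbb{K}^n$ is $\mathcal{A}_G=\{\ker(x_i-x_j):\{v_i,v_j\}\text{ an edge of }G\}$. The graph $Q_\ell(M)$ consists of the complete graph on $[\ell]=\{1,\dots,\ell\}$ together with, for each pair $1\le i<j\le\ell$, $m_{ij}$ additional new vertices each adjacent exactly to $i$ and $j$ (i.e. $m_{ij}$ triangles attached to the edge $\{i,j\}$). For a central arrangement $\mathcal{A}$ in $V=\mathbb{K}^n$: $L(\mathcal{A})$ is the set of intersections of subsets of $\mathcal{A}$ (including $V$); $\mathcal{A}^X=\{H\cap X:H\in\mathcal{A},X\not\subseteq H\}$; $\mathcal{A}$ is free if $D(\mathcal{A})=\{\theta\in\mathrm{Der}(S):\theta(\alpha_H)\in\alpha_HS\ \forall H\}$ is free over $S=\mathbb{K}[x_1,\dots,x_n]$, exponents being the degrees of a homogeneous basis. $\mathcal{A}$ is flag-accurate if it is free with exponents $e_1\le\dots\le e_n$ and there is a flag $X_1\subseteq\dots\subseteq X_n=V$ in $L(\mathcal{A})$ with $\dim X_d=d$ and $\mathcal{A}^{X_d}$ free with exponents $(e_1,\dots,e_d)$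 for all $d$. *)

(* Defs.v *)
From HB Require Import structures.
From mathcomp Require Import all_boot all_order all_algebra finmap.
From mathcomp Require Import mpoly.

Set Implicit Arguments.
Unset Strict Implicit.
Unset Printing Implicit Defensive.

Import GRing.Theory.

Local Open Scope fset_scope.
Local Open Scope ring_scope.

Definition is_derivation (K : fieldType) (n : nat)
    (theta : {mpoly K[n]} -> {mpoly K[n]}) : Prop :=
  linear theta /\
  (forall f g, theta (f * g) = theta f * g + f * theta g).

(* Homogeneous of polynomial degree [d]: [theta] is the sum of the f_i d/dx_i
   with every f_i = theta x_i homogeneous of degree [d]. *)
Definition der_homog (K : fieldType) (n d : nat)
    (theta : {mpoly K[n]} -> {mpoly K[n]}) : Prop :=
  forall i : 'I_n, theta 'X_i \is d.-homog.

Section Arrangements.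
Variables (K : fieldType) (V : vectType K).

(* A central arrangement in [V] is a finite set of hyperplanes of [V], given as
   a term of type {fset {vspace V}}. *)

(* A basis [b] of [V] identifies the symmetric algebra of the dual of [V] with
   the polynomial ring S in the coordinate functions ['X_i] dual to [b]. *)
Definition linform_poly (b : (\dim {:V}).-tuple V) (alpha : 'Hom(V, K^o)) :
    {mpoly K[\dim {:V}]} :=
  \sum_i (alpha (tnth b i) : K) *: 'X_i.

(* theta belongs to D(A). The defining forms of a hyperplane differ by nonzero
   scalars, so it does not matter which one is used. *)
Definition log_derivation (b : (\dim {:V}).-tuple V) (A : {fset {vspace V}})
    (theta : {mpoly K[\dim {:V}]} -> {mpoly K[\dim {:V}]}) : Prop :=
  is_derivation theta /\
  (forall (H : {vspace V}) (alpha : 'Hom(V, K^o)),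
     H \in A -> lker alpha = H ->
     exists q, theta (linform_poly b alpha) = linform_poly b alpha * q).

Definition free_with_exponents_in (b : (\dim {:V}).-tuple V)
    (A : {fset {vspace V}}) (e : seq nat) : Prop :=
  exists theta : 'I_(size e) -> {mpoly K[\dim {:V}]} -> {mpoly K[\dim {:V}]},
    [/\ forall i, log_derivation b A (theta i),
        forall i : 'I_(size e), der_homog (nth 0%N e i) (theta i)
      & forall eta, log_derivation b A eta ->
          exists! c : {ffun 'I_(size e) -> {mpoly K[\dim {:V}]}},
            forall f, eta f = \sum_i c i * theta i f].

(* A change of basis of [V] induces a graded automorphism of S, so this holds
   for every basis as soon as it holds for one. *)
Definition free_with_exponents (A : {fset {vspace V}}) (e : seq nat) : Prop :=
  forall b : (\dim {:V}).-tuple V,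
    basis_of {:V} b -> free_with_exponents_in b A e.

Definition in_lattice (A : {fset {vspace V}}) (X : {vspace V}) : Prop :=
  exists2 B : {fset {vspace V}},
    B `<=` A & X = (\bigcap_(H <- B) H)%VS.

(* The arrangement A^X in the vector space [X]: the preimage of [H] under the
   inclusion of [X] into [V] is the intersection of [H] and [X]. *)
Definition restriction (A : {fset {vspace V}}) (X : {vspace V}) :
    {fset {vspace (subvs_of X)}} :=
  [fset (linfun (vsval : subvs_of X -> V) @^-1: H)%VS
     | H in A & ~~ (X <= H)%VS].

End Arrangements.

Definition flag_accurate (K : fieldType) (V : vectType K)
    (A : {fset {vspace V}}) : Prop :=
  exists (e : seq nat) (X : nat -> {vspace V}),
    [/\ size e = \dim {:V}, sorted leq e & free_with_exponents A e] /\
    [/\ forall d, (0 < d <= \dim {:V})%N ->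
          [/\ in_lattice A (X d), \dim (X d) = d
            & free_with_exponents (restriction A (X d)) (take d e)],
        forall d, (0 < d < \dim {:V})%N -> (X d <= X d.+1)%VS
      & X (\dim {:V}) = {:V}%VS].

Record sgraph (T : finType) := SGraph {
  edge :> rel T;
  edge_sym : ssrbool.symmetric edge;
  edge_irrefl : irreflexive edge
}.

Section Graphic.
Variables (K : fieldType) (T : finType).

Definition coord_diff (u v : T) (x : {ffun T -> K^o}) : K^o := x u - x v.

Fact coord_diff_is_linear (u v : T) : linear (coord_diff u v).
Proof.
move=> a x y; rewrite /coord_diff !ffunE scalerBr opprD.
by rewrite addrACA.
Qed.

HB.instance Definition _ (u v : T) :=
  GRing.isLinear.Build K {ffun T -> K^o} K^o *:%R (coord_diff u v)
    (coord_diff_is_linear u v).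

Definition graphic_arrangement (G : sgraph T) : {fset {vspace {ffun T -> K^o}}} :=
  [fset lker (linfun (coord_diff p.1 p.2)) | p : T * T & G p.1 p.2].

End Graphic.

Section TriangleGraph.
Variables (l : nat) (m : 'I_l -> 'I_l -> nat).

(* The new vertices: pairs (i, j) with i < j, tagged with a number k < m i j.
   Only the values [m i j] with i < j are used. *)
Definition new_vertex : finType :=
  {p : 'I_l * 'I_l & 'I_(if (p.1 < p.2)%N then m p.1 p.2 else 0%N)}.

Definition Qedge : rel ('I_l + new_vertex) := fun u v =>
  match u, v with
  | inl i, inl j => i != j
  | inl k, inr w | inr w, inl k => (k == (tag w).1) || (k == (tag w).2)
  | inr _, inr _ => false
  end.

Fact Qedge_sym : ssrbool.symmetric Qedge.
Proof. by case=> [i|w] [j|w'] //=; rewrite eq_sym. Qed.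

Fact Qedge_irrefl : irreflexive Qedge.
Proof. by case=> [i|w] //=; rewrite eqxx. Qed.

Definition Q : sgraph ('I_l + new_vertex)%type := SGraph Qedge_sym Qedge_irrefl.

End TriangleGraph.

(* Main.v *)
From HB Require Import structures.
Require Import Defs.
From mathcomp Require Import all_boot all_order all_algebra finmap zify.
From mathcomp Require Import mpoly.

(** The vertices of the l-clique are coloured by 0, 1, 2 so that neighbours on
    the cycle get different colours (and 0, 1, 2 keep their own). List the
    vertices as 0, 1, 2, then all triangle vertices, then 3, 4, ... Truncating
    this list after [d] entries, send every removed clique vertex to the
    representative of its colour (to 0 if that is removed too) and every removed
    triangle vertex to where one of its two neighbours goes. This contracts the
    graph to its first [d] vertices, and the corresponding flat is [X_d]. As the
    colouring is proper, a surviving triangle keeps two distinct neighbours, so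
    the contracted graph is again a clique with triangles attached.

    Such a graph has an explicit basis of logarithmic derivations: for the clique
    vertex [j], sum over [v] of prod_(i < j) (x_v - x_i) d/dx_v, of degree [j],
    and for a triangle vertex [w] on [a], [c], (x_w - x_a) (x_w - x_c) d/dx_w. It
    is triangular with diagonal entries that divide the relevant coefficient of
    every logarithmic derivation, because distinct linear forms are coprime. *)

Set Implicit Arguments.
Unset Strict Implicit.
Unset Printing Implicit Defensive.

Import GRing.Theory.

Local Open Scope ring_scope.

(** * Derivations of a polynomial ring *)

Section MPolyFacts.
Variables (K : fieldType) (n : nat).
Implicit Types (f g : {mpoly K[n]}) (eta theta : {mpoly K[n]} -> {mpoly K[n]}).

Lemma mpoly_alg_ind (P : {mpoly K[n]} -> Prop) :
  (forall c, P c%:MP) -> (forall i, P 'X_i) ->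
  (forall f g, P f -> P g -> P (f + g)) ->
  (forall f g, P f -> P g -> P (f * g)) -> forall f, P f.
Proof.
move=> PC PX PD PM; elim/mpolyind=> [|c m f _ _ Pf].
  by rewrite -[0]/(0%:MP).
apply: (PD) Pf; rewrite -mul_mpolyC; apply: (PM) => //; rewrite mpolyXE_id.
elim/big_ind: _ => [|f1 f2|i _]; [exact: PC | exact: PM |].
by elim: (m i) => [|k IHk]; [exact: PC | rewrite exprS; apply: PM].
Qed.

Lemma derivationD theta f g :
  is_derivation theta -> theta (f + g) = theta f + theta g.
Proof. by case=> lin_theta _; have := lin_theta 1 f g; rewrite !scale1r. Qed.

Lemma derivation0 theta : is_derivation theta -> theta 0 = 0.
Proof.
by move=> dth; apply: (addrI (theta 0)); rewrite -(derivationD 0 0 dth) !addr0.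
Qed.

Lemma derivationZ theta c f :
  is_derivation theta -> theta (c *: f) = c *: theta f.
Proof.
move=> dth; have [lin_theta _] := dth.
by have := lin_theta c f 0; rewrite (derivation0 dth) !addr0.
Qed.

Lemma derivationB theta f g :
  is_derivation theta -> theta (f - g) = theta f - theta g.
Proof. by move=> dth; rewrite -!scaleN1r (derivationD _ _ dth) (derivationZ _ _ dth). Qed.

Lemma derivation_sum theta (I : Type) (r : seq I) (F : I -> {mpoly K[n]}) :
  is_derivation theta -> theta (\sum_(i <- r) F i) = \sum_(i <- r) theta (F i).
Proof.
by move=> dth; apply: (big_morph theta); [move=> *; apply: derivationD | apply: derivation0].
Qed.

Lemma derivationC theta c : is_derivation theta -> theta c%:MP = 0.
Proof.
move=> dth; rewrite -[c%:MP]mulr1 mul_mpolyC (derivationZ _ _ dth).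
have [_ /(_ 1 1)] := dth; rewrite !mulr1 mul1r => /eqP.
by rewrite -subr_eq0 opprD addNKr oppr_eq0 => /eqP->; rewrite scaler0.
Qed.

Lemma derivation_ext theta eta :
  is_derivation theta -> is_derivation eta ->
  (forall i, theta 'X_i = eta 'X_i) -> theta =1 eta.
Proof.
move=> dth deta eqX; elim/mpoly_alg_ind => [c||f g ef eg|f g ef eg] //.
- by rewrite (derivationC c dth) (derivationC c deta).
- by rewrite (derivationD _ _ dth) (derivationD _ _ deta) ef eg.
by have [_ ->] := dth; have [_ ->] := deta; rewrite ef eg.
Qed.

Lemma derivation_comb (I : Type) (r : seq I) (c : I -> {mpoly K[n]})
    (th : I -> {mpoly K[n]} -> {mpoly K[n]}) :
  (forall i, is_derivation (th i)) ->
  is_derivation (fun f => \sum_(i <- r) c i * th i f).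
Proof.
move=> dth; split=> [a f g|f g].
  rewrite scaler_sumr -big_split; apply: eq_bigr => i _ /=.
  by rewrite (derivationD _ _ (dth i)) (derivationZ _ _ (dth i)) mulrDr scalerAr.
rewrite mulr_suml mulr_sumr -big_split; apply: eq_bigr => i _ /=.
by have [_ ->] := dth i; rewrite mulrDr mulrA; congr (_ + _); rewrite mulrCA.
Qed.

Lemma mderiv_is_derivation i : is_derivation (mderiv i : {mpoly K[n]} -> _).
Proof. by split; [exact: mderiv_is_linear | exact: mderivM]. Qed.

End MPolyFacts.

(** * Linear forms as polynomials, constant vector fields and primality of linear forms *)

Section DualPair.
Variables (K : fieldType) (V : vectType K) (b : (\dim {:V}).-tuple V).
Hypothesis b_basis : basis_of {:V} b.
Notation n := (\dim {:V}).
Notation L := (linform_poly b).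
Implicit Types (phi psi : 'Hom(V, K^o)) (v : V) (f g : {mpoly K[n]}).

Lemma linform_polyD phi psi : L (phi + psi) = L phi + L psi.
Proof.
rewrite -big_split; apply: eq_bigr => i _ /=.
by rewrite add_lfunE scalerDl.
Qed.

Lemma linform_polyZ a phi : L (a *: phi) = a *: L phi.
Proof.
rewrite scaler_sumr; apply: eq_bigr => i _ /=.
by rewrite scale_lfunE scalerA.
Qed.

Lemma linform_polyB phi psi : L (phi - psi) = L phi - L psi.
Proof. by rewrite linform_polyD -scaleN1r linform_polyZ scaleN1r. Qed.

Lemma linform_poly_homog phi : L phi \is 1.-homog.
Proof. by apply: rpred_sum => i _; apply: rpredZ; rewrite dhomogX; apply/eqP/mdeg1. Qed.

Definition dirderiv v f := \sum_i (coord b i v)%:MP * mderiv i f.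

Lemma dirderiv_is_derivation v : is_derivation (dirderiv v).
Proof. exact: derivation_comb (@mderiv_is_derivation _ _). Qed.

Lemma dirderivX v i : dirderiv v 'X_i = (coord b i v)%:MP.
Proof.
rewrite /dirderiv (bigD1 i) //= mderivX mnm1E eqxx scale1r.
rewrite -{1}[U_(i)%MM]add0m addmK mpolyX0 mulr1.
rewrite big1 ?addr0 // => j ne_ji.
by rewrite mderivX mnm1E eq_sym (negbTE ne_ji) scale0r mulr0.
Qed.

Lemma lfun_coordE phi v : phi v = \sum_i coord b i v *: phi (tnth b i).
Proof.
rewrite {1}(coord_basis b_basis (memvf v)) linear_sum; apply: eq_bigr => i _.
by rewrite linearZ -tnth_nth.
Qed.

Lemma dirderiv_linform v phi : dirderiv v (L phi) = (phi v)%:MP.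
Proof.
have dD := dirderiv_is_derivation v.
rewrite (derivation_sum _ _ dD) lfun_coordE raddf_sum; apply: eq_bigr => i _ /=.
by rewrite (derivationZ _ _ dD) dirderivX -mul_mpolyC -mpolyCM mulrC.
Qed.

Lemma linform_poly_neq0 v phi : phi v != 0 -> L phi != 0.
Proof.
apply: contraNneq => L0; have := dirderiv_linform v phi.
by rewrite L0 (derivation0 (dirderiv_is_derivation v)) => /esym/eqP; rewrite mpolyC_eq0.
Qed.

(** Pullback along the map x |-> x - phi(x) v. When phi(v) = 1 this map is the projection onto the
    kernel of [phi] along [v], so the shear sends [L phi] to 0. *)
Definition shear v phi f := f \mPo [tuple 'X_i - coord b i v *: L phi | i < n].

Lemma shear_linform v phi psi :
  shear v phi (L psi) = L psi - psi v *: L phi.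
Proof.
rewrite /shear {1}/linform_poly raddf_sum /=.
under eq_bigr => i _.
  rewrite comp_mpolyZ comp_mpolyXU -tnth_nth tnth_mktuple scalerBr; over.
rewrite sumrB; congr (_ - _); rewrite lfun_coordE scaler_suml.
by apply: eq_bigr => i _; rewrite scalerA mulrC.
Qed.

(** The substitution changes each variable by a multiple of [L phi], so it is the identity modulo
    [L phi]. *)
Lemma shear_dvd v phi f : exists q, f - shear v phi f = L phi * q.
Proof.
elim/mpoly_alg_ind: f => [c|i|f g [qf ef] [qg eg]|f g [qf ef] [qg eg]].
- by exists 0; rewrite /shear comp_mpolyC subrr mulr0.
- exists (coord b i v)%:MP; rewrite /shear comp_mpolyXU -tnth_nth tnth_mktuple.
  by rewrite opprB addrC subrK -mul_mpolyC mulrC.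
- by exists (qf + qg); rewrite mulrDr -ef -eg /shear raddfD /= opprD addrACA.
exists (qf * g + shear v phi f * qg); rewrite mulrDr mulrA -ef mulrCA -eg.
by rewrite /shear rmorphM /= mulrBl mulrBr addrA subrK.
Qed.

(* The shear along [v] is the substitution with kernel generated by [L phi], so
   [L phi] is prime. *)
Lemma linform_dvd_mul v phi psi f q :
  phi v = 1 -> (exists w, psi w != psi v * phi w) ->
  L psi * f = L phi * q -> exists q', f = L phi * q'.
Proof.
move=> phi_v [w psi_w] /(congr1 (shear v phi)).
rewrite /shear !rmorphM /= -!/(shear _ _ _) !shear_linform phi_v scale1r subrr.
rewrite mul0r => /eqP; rewrite mulf_eq0 => /orP[|/eqP sf0]; last first.
  by have [q' eq'] := shear_dvd v phi f; exists q'; rewrite -eq' sf0 subr0.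
rewrite -linform_polyZ -linform_polyB => /eqP L0.
suff /linform_poly_neq0/eqP: (psi - psi v *: phi) w != 0 by [].
by rewrite add_lfunE opp_lfunE scale_lfunE subr_eq0.
Qed.

End DualPair.

(** * A triangularity criterion for freeness *)

Section Triangular.
Variables (K : fieldType) (V : vectType K) (b : (\dim {:V}).-tuple V).
Hypothesis b_basis : basis_of {:V} b.
Variables (T : eqType) (t0 : T) (S : seq T) (phi : T -> 'Hom(V, K^o)) (ev : T -> V).
Hypothesis S_uniq : uniq S.
Hypothesis dual : {in S &, forall s t, phi s (ev t) = (s == t)%:R}.
Hypothesis expand : forall v, v = \sum_(t <- S) phi t v *: ev t.
Notation n := (\dim {:V}).
Notation L := (linform_poly b).
Notation y := (fun s => linform_poly b (phi s)).

(** The vectors [ev t], t in [S], form a basis of [V] with dual coordinates [phi t]. This is the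
    derivation with coefficients [g v] in these coordinates, whatever basis [b] identifies the
    polynomial ring. *)
Definition vfield (g : T -> {mpoly K[n]}) (f : {mpoly K[n]}) :=
  \sum_(v <- S) g v * dirderiv b (ev v) f.

Lemma vfield_is_derivation g : is_derivation (vfield g).
Proof. exact: derivation_comb (fun v => dirderiv_is_derivation b (ev v)). Qed.

Lemma vfield_coord g s : s \in S -> vfield g (y s) = g s.
Proof.
move=> sS; rewrite /vfield (bigD1_seq s) //= dirderiv_linform // dual // eqxx.
rewrite mpolyC1 mulr1 big_seq_cond big1 ?addr0 // => v /andP[vS ne_vs].
by rewrite dirderiv_linform // dual // eq_sym (negbTE ne_vs) mpolyC0 mulr0.
Qed.

Lemma vfield_homog g d :
  {in S, forall v, g v \is d.-homog} -> der_homog d (vfield g).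
Proof.
move=> homog_g i; rewrite /vfield big_seq; apply: rpred_sum => v vS.
by rewrite dirderivX mulrC mul_mpolyC; apply/rpredZ/homog_g.
Qed.

(** The variables are linear combinations of the [y v], so a derivation is determined by its values
    on the [y v]. *)
Lemma mpolyX_coord i : 'X_i = \sum_(v <- S) coord b i (ev v) *: y v.
Proof.
under eq_bigr => v _ do rewrite /linform_poly scaler_sumr.
rewrite exchange_big /=; transitivity (\sum_k (k == i)%:R *: ('X_k : {mpoly K[n]})).
  rewrite (bigD1 i) //= eqxx scale1r big1 ?addr0 // => k /negbTE->.
  by rewrite scale0r.
apply: eq_bigr => k _; rewrite -(coord_free k i (basis_free b_basis)) -tnth_nth.
rewrite {1}[tnth b k]expand linear_sum scaler_suml; apply: eq_bigr => v _.
by rewrite linearZ /= -!mul_mpolyC mulrA -mpolyCM; congr (_%:MP * _); rewrite mulrC.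
Qed.

Lemma derivation_ext_coord theta eta :
  is_derivation theta -> is_derivation eta ->
  {in S, forall v, theta (y v) = eta (y v)} -> theta =1 eta.
Proof.
move=> dth deta eq_y; apply: derivation_ext => // i.
rewrite mpolyX_coord (derivation_sum _ _ dth) (derivation_sum _ _ deta).
apply: eq_big_seq => v vS.
by rewrite (derivationZ _ _ dth) (derivationZ _ _ deta) eq_y.
Qed.

Lemma log_derivation_subM (A : {fset {vspace V}}) q theta eta :
  log_derivation b A theta -> log_derivation b A eta ->
  log_derivation b A (fun f => theta f - q * eta f).
Proof.
move=> [[lin_th mul_th] A_th] [[lin_eta mul_eta] A_eta].
split; [split=> [a f g|f g]|move=> H alpha HA ker_alpha].
- by rewrite lin_th lin_eta scalerBr mulrDr scalerAr opprD addrACA.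
- rewrite mul_th mul_eta mulrBl mulrBr mulrDr opprD addrACA mulrA.
  by congr (_ + (_ - _)); rewrite mulrCA.
have [[q1 ->] [q2 ->]] := (A_th H alpha HA ker_alpha, A_eta H alpha HA ker_alpha).
by exists (q1 - q * q2); rewrite mulrBr mulrCA.
Qed.

Variables (A : {fset {vspace V}}) (g : T -> T -> {mpoly K[n]}).
Variables (r deg : T -> nat).
Hypothesis g_log : {in S, forall j, log_derivation b A (vfield (g j))}.
Hypothesis g_homog : {in S &, forall j v, g j v \is (deg j).-homog}.
Hypothesis g_trig :
  {in S &, forall j v, v != j -> (r v <= r j)%N -> g j v = 0}.
Hypothesis g_diag : {in S, forall j, g j j != 0}.
Hypothesis g_dvd : {in S, forall j eta, log_derivation b A eta ->
  {in S, forall v, (r v < r j)%N -> eta (y v) = 0} ->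
  exists q, eta (y j) = g j j * q}.

Let S' := sort (relpre r leq) S.

Let S'P s1 j s2 : S' = s1 ++ j :: s2 ->
  [/\ j \in S, {in s1, forall v, [/\ v \in S, v != j & r v <= r j]%N}
    & {in S, forall v, (r v < r j)%N -> v \in s1}].
Proof.
move=> eS; have memS v : (v \in S) = (v \in s1 ++ j :: s2).
  by rewrite -eS mem_sort.
have: uniq S' by rewrite sort_uniq.
have: pairwise (relpre r leq) S'.
  rewrite -sorted_pairwise; last by move=> u v w; apply: leq_trans.
  by apply: sort_sorted => u v; apply: leq_total.
rewrite eS pairwise_cat /= cat_uniq /= => /and3P[/allrelP le12 _ /andP[/allP le_j _]].
move=> /and3P[_ /norP[js1 _] /andP[js2 _]]; split=> [|v vs1|v vS lt_vj].
- by rewrite memS mem_cat mem_head orbT.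
- split; [by rewrite memS mem_cat vs1 | by apply: contraNneq js1 => <- |].
  by apply: le12 => //; apply: mem_head.
move: vS; rewrite memS mem_cat inE => /or3P[//|/eqP ev_j|/le_j /=].
  by rewrite ev_j ltnn in lt_vj.
by rewrite leqNgt lt_vj.
Qed.

(** Elimination in order of rank: [s1] holds the coordinates already cleared. The diagonal entry
    divides the next coefficient of [eta], and subtracting the matching multiple of [vfield (g j)]
    leaves the cleared coordinates at 0. Since [g_trig] also covers ties, any sorting by [r]
    serves. *)
Let triangular_generates s2 s1 eta : S' = s1 ++ s2 -> log_derivation b A eta ->
  {in s1, forall v, eta (y v) = 0} ->
  exists c : T -> {mpoly K[n]},
    forall f, eta f = \sum_(j <- s2) c j * vfield (g j) f.
Proof.
elim: s2 s1 eta => [|j s2 IHs] s1 eta eS log_eta eta0.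
  exists (fun=> 0); apply: derivation_ext_coord; first by have [] := log_eta.
    apply: (derivation_comb [::] (fun=> 0)) => v.
    exact: (vfield_is_derivation (g v)).
  by move=> v; rewrite -(mem_sort (relpre r leq)) -/S' eS cats0 => /eta0->; rewrite big_nil.
have [jS s1P ltP] := S'P eS.
have [q eta_j] : exists q, eta (y j) = g j j * q.
  by apply: g_dvd => // v vS /(ltP v vS)/eta0.
have [|||c eta_c] := IHs (rcons s1 j) (fun f => eta f - q * vfield (g j) f).
- by rewrite cat_rcons.
- by apply: log_derivation_subM => //; apply: g_log.
- move=> v; rewrite mem_rcons inE => /predU1P[->|vs1].
    by rewrite vfield_coord // eta_j mulrC subrr.
  have [vS ne_vj le_vj] := s1P v vs1.
  by rewrite vfield_coord // eta0 // g_trig // mulr0 subrr.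
exists (fun i => if i == j then q else c i) => f.
have js2 : j \notin s2.
  have: uniq S' by rewrite sort_uniq.
  by rewrite eS cat_uniq /= => /and4P[].
rewrite big_cons eqxx -[LHS](subrK (q * vfield (g j) f)) addrC eta_c.
by congr (_ + _); apply: eq_big_seq => i is2; case: eqP js2 => // <-; rewrite is2.
Qed.

(** On the coordinate of the first remaining index all later derivations vanish, so the relation
    reduces to its diagonal term there and the first coefficient is 0. *)
Let triangular_free s2 s1 (c : T -> {mpoly K[n]}) : S' = s1 ++ s2 ->
  (forall f, \sum_(j <- s2) c j * vfield (g j) f = 0) ->
  {in s2, forall j, c j = 0}.
Proof.
elim: s2 s1 => [|j s2 IHs] s1 // eS c0.
have [jS s1P ltP] := S'P eS.
have js2 v : v \in s2 -> [/\ v \in S, j != v & r j <= r v]%N.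
  move=> vs2; have [s3 [s4 es2]] : exists s3 s4, s2 = s3 ++ v :: s4.
    by case/splitPr: vs2 => s3 s4; exists s3, s4.
  have eS3 : S' = (s1 ++ j :: s3) ++ v :: s4 by rewrite eS es2 -catA.
  have [vS /(_ j)[|//] ] := S'P eS3; first by rewrite mem_cat mem_head orbT.
have cj0 : c j = 0.
  have := c0 (y j); rewrite big_cons vfield_coord // big_seq big1 => [|v vs2].
    by move/eqP; rewrite addr0 mulf_eq0 (negbTE (g_diag jS)) orbF => /eqP.
  by have [vS ne_jv le_jv] := js2 v vs2; rewrite vfield_coord // g_trig // mulr0.
move=> v; rewrite inE => /predU1P[->//|]; apply: (IHs (rcons s1 j)).
  by rewrite cat_rcons.
by move=> f; have := c0 f; rewrite big_cons cj0 mul0r add0r.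
Qed.

(** Elimination runs along [S'], but the basis is indexed by [S], so the exponents come out in the
    order of [S]. *)
Lemma free_triangular : free_with_exponents_in b A (map deg S).
Proof.
have perm_S : perm_eq S' S by rewrite perm_sort.
pose th i := vfield (g (nth t0 S i)).
have sumE (c : T -> {mpoly K[n]}) f :
    \sum_(i < size (map deg S)) c (nth t0 S i) * th i f =
    \sum_(j <- S') c j * vfield (g j) f.
  rewrite (perm_big _ perm_S) (big_nth t0) big_mkord size_map.
  by [].
have ltS (i : 'I_(size (map deg S))) : (i < size S)%N.
  by rewrite -(size_map deg).
exists (fun i => th i); split=> [i|i|eta log_eta].
- by apply/g_log/mem_nth.
- rewrite (nth_map t0) //; apply: vfield_homog => v vS.
  by apply: g_homog => //; apply: mem_nth.
have [c eta_c] := @triangular_generates S' [::] eta erefl log_eta (fun=> ltac:(done)).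
exists [ffun i : 'I_(size (map deg S)) => c (nth t0 S i)]; split=> [f|c' eta_c'].
  by rewrite eta_c -sumE; apply: eq_bigr => i _; rewrite ffunE.
(* The competing coefficients, indexed by positions in [S], are carried over to elements of [T],
   with 0 outside [S], so that [triangular_free] applies to the difference. *)
pose c1 t := if insub (index t S) is Some i then c' i else 0.
have c1E (i : 'I_(size (map deg S))) : c1 (nth t0 S i) = c' i.
  by rewrite /c1 index_uniq // valK.
apply/ffunP=> i; rewrite ffunE; apply/eqP; rewrite -subr_eq0 -c1E; apply/eqP.
apply: (@triangular_free S' [::] (fun t => c t - c1 t)) => //.
  move=> f; under eq_bigr => j _ do rewrite mulrBl.
  rewrite sumrB -eta_c -sumE eta_c' -sumrB big1 // => k _.
  by rewrite c1E subrr.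
by rewrite mem_sort mem_nth.
Qed.

End Triangular.

(** * Divisibility by products of linear forms *)

Section LinearDivisors.
Variables (K : fieldType) (V : vectType K) (b : (\dim {:V}).-tuple V).
Hypothesis b_basis : basis_of {:V} b.
Variables (T : eqType) (S : seq T) (phi : T -> 'Hom(V, K^o)) (ev : T -> V).
Hypothesis dual : {in S &, forall s t, phi s (ev t) = (s == t)%:R}.
Notation L := (linform_poly b).
Notation y := (fun s => linform_poly b (phi s)).

(** The forms [y j - y h] for distinct [h] are pairwise non-proportional primes, so divisibility by
    each gives divisibility by the product. *)
Lemma prod_coord_diff_dvd j (N : seq T) f :
  j \in S -> uniq N -> {subset N <= S} -> j \notin N ->
  {in N, forall h, exists q, f = (y j - y h) * q} ->
  exists q, f = \prod_(h <- N) (y j - y h) * q.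
Proof.
move=> jS; elim: N => [|h N IHN] /=; first by exists f; rewrite big_nil mul1r.
move=> /andP[hN uN] sNS; rewrite inE => /norP[ne_jh jN] f_dvd.
have hS : h \in S by apply: sNS; apply: mem_head.
have {}sNS : {subset N <= S} by move=> i iN; apply: sNS; rewrite inE iN orbT.
have f_dvdN i : i \in N -> exists q, f = (y j - y i) * q.
  by move=> iN; apply: f_dvd; rewrite inE iN orbT.
have [q eq_f] := IHN uN sNS jN f_dvdN.
have [q0] := f_dvd h (mem_head _ _); rewrite eq_f big_cons.
(* The prime [y j - y h] divides the product over [N] times [q]; removing the other factors one at a
   time shows that it divides [q]. *)
suff peel (M : seq T) q1 : {subset M <= N} ->
    \prod_(i <- M) (y j - y i) * q = (y j - y h) * q1 ->
    exists q2, q = (y j - y h) * q2.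
  by case/peel=> // q2 ->; exists q2; rewrite mulrA [_ * (y j - _)]mulrC.
elim: M q1 => [|i M IHM] q1 sMN; first by rewrite big_nil mul1r; exists q1.
have iN : i \in N by apply: sMN; apply: mem_head.
rewrite big_cons -mulrA -!linform_polyB => /(linform_dvd_mul b_basis (v := ev j)).
have ne_ih : i != h by apply: contraNneq hN => <-.
have ne_ij : i != j by apply: contraNneq jN => <-.
have iS := sNS i iN.
case=> [||q2].
- by rewrite add_lfunE opp_lfunE !dual // eqxx eq_sym (negbTE ne_jh) subr0.
(* At [ev h] the form of [i] is 0 while that of [h] is -1; both are 1 at [ev j], so they are not
   proportional. *)
- exists (ev h); rewrite !add_lfunE !opp_lfunE !dual // !eqxx (negbTE ne_ih).
  rewrite (negbTE ne_ij) (negbTE ne_jh) !subr0 sub0r mul1r.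
  by rewrite eq_sym oppr_eq0 oner_neq0.
by rewrite linform_polyB; apply: IHM => k kM; apply: sMN; rewrite inE kM orbT.
Qed.

Lemma eq_lker_scale (alpha beta : 'Hom(V, K^o)) :
  lker alpha = lker beta -> exists c, alpha = c *: beta.
Proof.
move=> eq_ker; have kerE v : (alpha v == 0) = (beta v == 0).
  by rewrite -!memv_ker eq_ker.
have [beta0|/lfunPn[z]] := eqVneq beta 0.
  exists 0; rewrite scale0r; apply/lfunP=> v.
  by rewrite lfunE; apply/eqP; rewrite kerE beta0 lfunE.
(* The factor is read off at a [z] outside the kernel; any [v] falls into the kernel after
   subtracting a multiple of [z]. *)
rewrite lfunE /= => bz; exists (alpha z / beta z); apply/lfunP=> v.
have := kerE (v - (beta v / beta z) *: z).
rewrite !linearB !linearZ /= /GRing.scale /= !mulrN divfK // subrr eqxx.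
rewrite subr_eq0 => /eqP->; rewrite scale_lfunE /GRing.scale /=.
by rewrite mulrAC [RHS]mulrAC [beta v * _]mulrC.
Qed.

Lemma log_derivationP (A : {fset {vspace V}}) theta :
  is_derivation theta ->
  (forall H, H \in A -> exists2 beta, H = lker beta &
     exists q, theta (L beta) = L beta * q) ->
  log_derivation b A theta.
Proof.
move=> dth A_th; split=> // H alpha HA ker_alpha.
have [beta eH [q th_beta]] := A_th H HA; rewrite eH in ker_alpha.
have [c ->] := eq_lker_scale ker_alpha; exists q.
by rewrite linform_polyZ (derivationZ _ _ dth) th_beta scalerAl.
Qed.

End LinearDivisors.

(** One polynomial in one variable evaluated at two points: the difference of values is divisible by
    the difference of points. This makes the clique derivations logarithmic along every edge. *)
Lemma prod_sub_dvd (R : comRingType) (I : Type) (r : seq I) (P : pred I)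
    (z : I -> R) x y :
  exists q, \prod_(i <- r | P i) (x - z i) - \prod_(i <- r | P i) (y - z i) =
            (x - y) * q.
Proof.
elim: r => [|i r [q IHr]]; first by exists 0; rewrite !big_nil subrr mulr0.
rewrite !big_cons; case: (P i); last by exists q.
set X := \prod_(_ <- r | _) _ in IHr *; set Y := \prod_(_ <- r | _) _ in IHr *.
exists (X + (y - z i) * q).
by rewrite mulrDr mulrCA -IHr mulrBr addrA -mulrDl addrA subrK.
Qed.

(** A prefix may cut through a block of equal keys, hence the strict inequality. *)
Lemma mem_take_sorted_key (T : eqType) (key : T -> nat) (s : seq T) d u v :
  sorted (relpre key leq) s -> v \in take d s -> u \in s ->
  (key u < key v)%N -> u \in take d s.
Proof.
rewrite sorted_pairwise => [|x y z]; last exact: leq_trans.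
rewrite -{1 3}(cat_take_drop d s) pairwise_cat mem_cat => /andP[/allrelP le_td _].
move=> vS /orP[//|/(le_td v u vS) /=].
by rewrite leqNgt => /negbTE->.
Qed.

(** * The colouring, the vertex order and the contractions *)

Section CycleTriangles.
Variables (l : nat) (m : 'I_l.+2 -> 'I_l.+2 -> nat).
Notation T := ('I_l.+2 + new_vertex m)%type.
Implicit Types (i j : 'I_l.+2) (w : new_vertex m) (u v : T).

(* A proper colouring of the cycle in which vertices 0, 1, 2 represent the
   three colours. *)
Definition color i : 'I_l.+2 :=
  inord (if i == ord0 then 0 else if odd i then 1 else 2)%N.

(** All triangle vertices share the key 3; clique vertices from 3 on are shifted by one to make
    room. *)
Definition key v :=
  match v with inl i => if (i < 3)%N then i : nat else i.+1 | inr _ => 3 end.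
(** The degree of the basis derivation attached to [v]. Along the vertex order it reads 0, 1, 2,
    then 2 for each triangle vertex, then 3, 4, ... *)
Definition deg v := match v with inl i => i : nat | inr _ => 2 end.
Definition vertex_order := sort (relpre key leq) (enum {: T}).

Definition base v : T :=
  inl (color (match v with inl i => i | inr w => (tag w).1 end)).

Definition contr d v : T :=
  if v \in take d vertex_order then v
  else if base v \in take d vertex_order then base v else inl ord0.

(** [inord] does not overflow: colour 2 is taken only by a nonzero even vertex, which requires at
    least three clique vertices. *)
Lemma val_color i :
  color i = (if i == ord0 then 0 else if odd i then 1 else 2)%N :> nat.
Proof.
rewrite inordK //; case: i => [[|[|i]] lt_i] //=.
by case: ifP => // _; case: (l) lt_i.
Qed.

Lemma color_lt3 i : (color i < 3)%N.
Proof. by rewrite val_color; do 2?case: ifP. Qed.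

Lemma color_id i : (i < 3)%N -> color i = i.
Proof.
by move=> lt_i3; apply/val_inj; rewrite /= val_color; case: i lt_i3 => [[|[|[|]]]].
Qed.

Lemma color_idem i : color (color i) = color i.
Proof. exact/color_id/color_lt3. Qed.

Lemma vertex_order_sorted : sorted (relpre key leq) vertex_order.
Proof. by apply: sort_sorted => u v; apply: leq_total. Qed.

Lemma vertex_order_uniq : uniq vertex_order.
Proof. by rewrite sort_uniq enum_uniq. Qed.

Lemma mem_vertex_order v : v \in vertex_order.
Proof. by rewrite mem_sort mem_enum. Qed.

Lemma size_vertex_order : size vertex_order = #|{: T}|.
Proof. by rewrite size_sort cardE. Qed.

Lemma deg_sorted : sorted leq (map deg vertex_order).
Proof.
rewrite sorted_map; apply: sub_sorted vertex_order_sorted => u v /=.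
by case: u => [i|w]; case: v => [j|w'] /=; do 2?case: ifP => ?; lia.
Qed.

Lemma mem_take_key d u v :
  v \in take d vertex_order -> (key u < key v)%N -> u \in take d vertex_order.
Proof.
move=> vS; apply: (mem_take_sorted_key vertex_order_sorted) => //.
exact: mem_vertex_order.
Qed.

Section Step.
Variable d : nat.
Notation S := (take d vertex_order).
Notation rho := (contr d).

Lemma core_mem_tri w i : inr w \in S -> (i < 3)%N -> inl i \in S.
Proof. by move=> wS lt_i3; apply: mem_take_key wS _; rewrite /= lt_i3. Qed.

(** Once some triangle vertex is removed, every surviving clique vertex is the representative of its
    own colour. *)
Lemma tri_notin_core w i : inr w \notin S -> inl i \in S -> (i < 3)%N.
Proof.
move=> wS iS; apply: contraNltn wS => le_3i; apply: mem_take_key iS _.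
by rewrite /=; case: ifP; lia.
Qed.

Lemma core_mem_lt i j : inl j \in S -> (i < j)%N -> inl i \in S.
Proof. by move=> jS lt_ij; apply: mem_take_key jS _ => /=; do 2?case: ifP; lia. Qed.

Lemma contr_id v : v \in S -> rho v = v.
Proof. by rewrite /contr => ->. Qed.

Lemma contr_tri v w : rho v = inr w -> v = inr w.
Proof. by rewrite /contr /base; case: ifP => //; case: ifP. Qed.

(** While a triangle vertex survives, so do 0, 1, 2; hence no clique vertex is sent to 0 by default
    and the contraction preserves colours. *)
Lemma contr_color i j w : inr w \in S -> rho (inl i) = rho (inl j) -> color i = color j.
Proof.
move=> wS; have colS k : inl (color k) \in S by rewrite (core_mem_tri wS) ?color_lt3.
rewrite /contr /base !colS; do 2!case: ifP => _; case=> /(congr1 color);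
  by rewrite ?color_idem.
Qed.

Lemma contr_core i : exists j, rho (inl i) = inl j.
Proof. by rewrite /contr /base; do 2?case: ifP => _; eexists. Qed.

Hypothesis d_gt0 : (0 < d)%N.

Lemma core0_mem : inl ord0 \in S.
Proof.
have: (0 < size S)%N.
  rewrite size_take size_vertex_order; case: ifP => // _.
  by apply/card_gt0P; exists (inl ord0).
case eS: S => [//|v s] _.
have vS : v \in S by rewrite eS mem_head.
have [<-|ne_v0] := eqVneq v (inl ord0); first by rewrite -eS.
rewrite -eS; apply: mem_take_key vS _; case: v ne_v0 {eS} => [i|w] //=.
by case: i => [[|i] lt_i] //= _; case: ifP.
Qed.

Lemma contr_mem v : rho v \in S.
Proof. by rewrite /contr; case: ifP => //; case: ifP => // _ _; apply: core0_mem. Qed.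

End Step.

(** Each contraction factors through the next finer one; this makes the flats nested. *)
Lemma contr_contr d v : (0 < d)%N -> contr d (contr d.+1 v) = contr d v.
Proof.
move=> d_gt0; have sS u : u \in take d vertex_order -> u \in take d.+1 vertex_order.
  by apply: mem_subseq; rewrite -(take_takel vertex_order (leqnSn d)) take_subseq.
rewrite {2}/contr; case: ifP => // /negbT vS1.
have vS : v \in take d vertex_order = false by apply: contraNF vS1; apply: sS.
case: ifP => [_|/negbT bS1].
  have baseK : base (base v) = base v by rewrite /base color_idem.
  by rewrite /contr vS baseK; case: (base v \in _).
rewrite contr_id ?core0_mem // /contr vS ifN //.
by apply: contraNN bS1; apply: sS.
Qed.

Hypothesis m_cycle : forall i j : 'I_l.+2, (i < j)%N ->
  [set i; j]%SET \notin [set [set k; ordS k]%SET | k : 'I_l.+2]%SET -> m i j = 0%N.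

Lemma tri_lt w : ((tag w).1 < (tag w).2)%N.
Proof. by case: w => p [k]; case: ifP. Qed.

Lemma tri_color w : color (tag w).1 != color (tag w).2.
Proof.
have lt_w := tri_lt w; case: w lt_w => [[i j] k] /= lt_ij.
have: (0 < m i j)%N by case: k => k; rewrite lt_ij /=; apply: leq_trans.
rewrite lt0n; apply: contraNneq => eq_c; rewrite m_cycle //.
apply/imsetP => [[k' _]] /setP eq_set.
(* For i < j a cycle edge means j = i + 1, or i = 0 with j the last vertex. Equal colours exclude
   both: only 0 has colour 0, and consecutive nonzero vertices differ in parity. *)
have: i != ord0 /\ j != i.+1 :> nat.
  have := congr1 val eq_c; rewrite /= !val_color.
  have j0 : j != ord0 by rewrite -val_eqE -lt0n; apply: leq_ltn_trans lt_ij.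
  rewrite (negbTE j0); have [_|i0 eq_odd] := eqVneq i ord0; first by case: ifP.
  split=> //; apply/eqP=> ej.
  by move: eq_odd; rewrite ej /=; case: odd.
have := eq_set i; have := eq_set j; rewrite !inE !eqxx /= orbT.
rewrite -!val_eqE /=; have := ltn_ord k'.
(* The last vertex is treated apart, because its cyclic successor wraps around to 0. *)
rewrite ltnS leq_eqVlt => /predU1P[->|lt_k]; first by rewrite modnn; lia.
by rewrite modn_small //; lia.
Qed.
End CycleTriangles.

(** * Freeness of the contracted arrangements *)

Section ContractionFree.
Variables (K : fieldType) (l : nat) (m : 'I_l.+2 -> 'I_l.+2 -> nat).
Hypothesis m_cycle : forall i j : 'I_l.+2, (i < j)%N ->
  [set i; j]%SET \notin [set [set k; ordS k]%SET | k : 'I_l.+2]%SET -> m i j = 0%N.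
Notation T := ('I_l.+2 + new_vertex m)%type.
Variable d : nat.
Hypothesis d_gt0 : (0 < d)%N.
Notation S := (take d (vertex_order m)).
Notation rho := (@contr l m d).
Variables (V : vectType K) (A : {fset {vspace V}}).
Variables (phi : T -> 'Hom(V, K^o)) (ev : T -> V).
Hypothesis dual : {in S &, forall s t, phi s (ev t) = (s == t)%:R}.
Hypothesis expand : forall v, v = \sum_(t <- S) phi t v *: ev t.
Hypothesis A_mem : forall H, H \in A <->
  exists u v, [/\ Qedge u v, rho u != rho v & H = lker (phi (rho u) - phi (rho v))].

Variables (b : (\dim {:V}).-tuple V) (b_basis : basis_of {:V} b).
Notation L := (linform_poly b).
Notation y := (fun s => linform_poly b (phi s)).

(** The ends of a triangle are taken after contraction, since the original neighbours of [w] may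
    have been removed. *)
Definition basis_coeff (j v : T) : {mpoly K[\dim {:V}]} :=
  match j with
  | inl j => \prod_(i : 'I_l.+2 | (i < j)%N) (y v - y (inl i))
  | inr w => if v == inr w then
      (y v - y (rho (inl (tag w).1))) * (y v - y (rho (inl (tag w).2))) else 0
  end.

(** The elimination order, different from [key]: clique derivations have components at triangle
    vertices, so all clique coordinates must be cleared before any triangle coordinate. *)
Definition rank (v : T) := match v with inl i => i : nat | inr _ => l.+2 end.

Let coord_diff_homog u v : y u - y v \is 1.-homog.
Proof. by rewrite -linform_polyB linform_poly_homog. Qed.

Lemma basis_coeff_homog j v : basis_coeff j v \is (deg j).-homog.
Proof.
case: j => [j|w] /=; last first.
  by case: ifP => _; [apply: (dhomogM (d := 1) (e := 1)) | apply: dhomog0].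
have jE : (\sum_(i : 'I_l.+2 | (i < j)%N) 1 = j)%N.
  by rewrite -(big_ord_widen _ (fun=> 1%N)) ?sum1_card ?card_ord // ltnW.
rewrite -{2}jE; apply: (big_rec2 (fun k p => p \is k.-homog)) => [|i k p _].
  exact: dhomog1.
exact: dhomogM.
Qed.

(** The place where the restriction of triangles to cycle edges enters: their ends have different
    colours. *)
Lemma tri_contr_neq w : inr w \in S -> rho (inl (tag w).1) != rho (inl (tag w).2).
Proof.
by move=> wS; apply: contraNneq (tri_color m_cycle w) => /(contr_color wS) ->.
Qed.

Lemma basis_coeff_dvd_edge j u v : j \in S -> Qedge u v -> rho u != rho v ->
  exists q, basis_coeff j (rho u) - basis_coeff j (rho v) =
            (y (rho u) - y (rho v)) * q.
Proof.
case: j => [j|w] /= jS uv ne_uv; first exact: prod_sub_dvd.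
(* Only [w] itself contracts to [w], so the other end of such an edge is one of its two neighbours,
   which contributes one of the two factors. *)
have half u' v' : Qedge u' v' -> rho u' = inr w -> rho v' != rho u' ->
    exists q, basis_coeff (inr w) (rho u') - basis_coeff (inr w) (rho v') =
              (y (rho u') - y (rho v')) * q.
  move=> uv' eu ne; rewrite /= eu eqxx; rewrite eu in ne; rewrite (negbTE ne) subr0.
  have eu' := contr_tri eu; subst u'; case: v' uv' {ne} => [i|//] /= /orP[] /eqP->.
    by exists (y (inr w) - y (rho (inl (tag w).2))).
  by exists (y (inr w) - y (rho (inl (tag w).1))); rewrite mulrC.
have [eu|ne_u] := eqVneq (rho u) (inr w).
  have [|q] := half u v uv eu; first by rewrite eq_sym.
  by rewrite /= eu eqxx => ->; exists q.
have [ev'|ne_v] := eqVneq (rho v) (inr w); last by exists 0; rewrite subrr mulr0.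
have [||q] := half v u _ ev'; [by rewrite -[Qedge _ _]/(Q m v u) edge_sym | by [] |].
rewrite /= ev' eqxx (negbTE ne_u) subr0 sub0r => ->.
by exists q; rewrite -mulNr opprB.
Qed.

Lemma basis_coeff_log j : j \in S -> log_derivation b A (vfield b S ev (basis_coeff j)).
Proof.
move=> jS; apply: log_derivationP; first exact: vfield_is_derivation.
move=> H /A_mem[u [v [uv ne_uv ->]]]; eexists; first by [].
have dth := vfield_is_derivation b S ev (basis_coeff j).
rewrite linform_polyB (derivationB _ _ dth) !(vfield_coord b_basis _ dual) ?contr_mem //.
- exact: basis_coeff_dvd_edge.
- exact: take_uniq (vertex_order_uniq m).
exact: take_uniq (vertex_order_uniq m).
Qed.

Lemma log_coord_dvd eta u v : log_derivation b A eta -> Qedge u v ->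
  rho u != rho v -> eta (y (rho v)) = 0 ->
  exists q, eta (y (rho u)) = (y (rho u) - y (rho v)) * q.
Proof.
move=> [deta A_eta] uv ne_uv eta_v0.
have [|//|q eq_q] := A_eta (lker (phi (rho u) - phi (rho v))) (phi (rho u) - phi (rho v)).
  by apply/A_mem; exists u, v.
exists q; rewrite -linform_polyB -eq_q linform_polyB (derivationB _ _ deta).
by rewrite eta_v0 subr0.
Qed.

(** Each factor of the diagonal entry comes from an edge joining [j] to a vertex of smaller rank,
    whose coordinate [eta] kills. The factors are coprime; for a triangle vertex this needs its two
    ends to stay distinct. *)
Lemma basis_coeff_dvd_log j eta : j \in S -> log_derivation b A eta ->
  {in S, forall v, (rank v < rank j)%N -> eta (y v) = 0} ->
  exists q, eta (y j) = basis_coeff j j * q.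
Proof.
move=> jS log_eta eta0; case: j jS eta0 => [j|w] jS eta0 /=.
  pose N : seq T := map inl [seq i : 'I_l.+2 <- index_enum 'I_l.+2 | (i < j)%N].
  have NP v : v \in N -> exists2 i : 'I_l.+2, v = inl i & (i < j)%N.
    by case/mapP=> i; rewrite mem_filter => /andP[lt_ij _] ->; exists i.
  have NS : {subset N <= S} by move=> v /NP[i ->]; apply: core_mem_lt jS.
  have [|||q ->] := prod_coord_diff_dvd b_basis dual (N := N) (f := eta (y (inl j))) jS _ NS.
  - rewrite map_inj_uniq; last by move=> ? ? [].
    by rewrite filter_uniq // index_enum_uniq.
  - by apply/negP=> /NP[i [->]]; rewrite ltnn.
  - move=> v vN; have vS := NS v vN; have [i ev_i lt_ij] := NP v vN.
    have [] := @log_coord_dvd eta (inl j) v log_eta.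
    + by rewrite ev_i /= -val_eqE gtn_eqF.
    + by rewrite !contr_id // ev_i; apply/eqP=> -[/(congr1 val)] /=; lia.
    + by rewrite contr_id // eta0 // ev_i.
    by move=> q; rewrite !contr_id // => ->; exists q.
  by exists q; rewrite big_map big_filter.
rewrite eqxx; set a := rho (inl _); set c := rho (inl _).
have dvd_end i : (i == (tag w).1) || (i == (tag w).2) ->
    exists q, eta (y (inr w)) = (y (inr w) - y (rho (inl i))) * q.
  move=> iw; have [i' ei] := contr_core m d i.
  have [||q] := @log_coord_dvd eta (inr w) (inl i) log_eta iw.
  - by rewrite contr_id // ei.
  - by apply: eta0; rewrite ?contr_mem // ei /=.
  by rewrite contr_id // => ->; exists q.
have [||||q ->] := prod_coord_diff_dvd b_basis dual (N := [:: a; c])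
  (f := eta (y (inr w))) jS.
- by rewrite /= inE andbT tri_contr_neq.
- by move=> v; rewrite !inE => /orP[] /eqP->; apply: contr_mem.
- rewrite !inE /a /c; have [i1 ->] := contr_core m d (tag w).1.
  by have [i2 ->] := contr_core m d (tag w).2.
- by move=> v; rewrite !inE => /orP[] /eqP->; apply: dvd_end; rewrite eqxx ?orbT.
by exists q; rewrite !big_cons big_nil mulr1.
Qed.

Lemma basis_coeff_trig j v : v \in S -> v != j -> (rank v <= rank j)%N ->
  basis_coeff j v = 0.
Proof.
case: j => [j|w] vS ne_vj /=; last by rewrite (negbTE ne_vj).
case: v vS ne_vj => [i|w] _ ne_ij /=; last by have := ltn_ord j; lia.
move=> le_ij; rewrite (bigD1 i) /= ?subrr ?mul0r //.
by rewrite ltn_neqAle le_ij andbT; apply: contraNneq ne_ij => /val_inj->.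
Qed.

Lemma basis_coeff_diag j : j \in S -> basis_coeff j j != 0.
Proof.
have coord_neq u v : u \in S -> v \in S -> u != v -> y u - y v != 0.
  move=> uS vS ne_uv; rewrite -linform_polyB.
  apply: (linform_poly_neq0 b_basis (v := ev u)).
  by rewrite add_lfunE opp_lfunE !dual // eqxx [v == u]eq_sym (negbTE ne_uv) subr0 oner_neq0.
case: j => [j|w] jS /=.
  rewrite prodf_seq_neq0; apply/allP=> i _; apply/implyP=> lt_ij.
  apply: (coord_neq _ _ jS (core_mem_lt jS lt_ij)).
  by apply/eqP=> -[/(congr1 val)] /=; lia.
rewrite eqxx mulf_neq0 // coord_neq ?contr_mem //.
  by have [i1 ->] := contr_core m d (tag w).1.
by have [i1 ->] := contr_core m d (tag w).2.
Qed.

Lemma basis_coeff_free : free_with_exponents_in b A (map (@deg l m) S).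
Proof.
apply: (free_triangular b_basis (inl ord0) _ dual expand (g := basis_coeff) (r := @rank)).
- exact: take_uniq (vertex_order_uniq m).
- exact: basis_coeff_log.
- by move=> j v _ _; apply: basis_coeff_homog.
- by move=> j v _; apply: basis_coeff_trig.
- exact: basis_coeff_diag.
by move=> j jS eta; apply: basis_coeff_dvd_log.
Qed.

End ContractionFree.

(** * Dual families, intersections and coordinate evaluations *)

Lemma dual_free (K : fieldType) (V : vectType K) (T : eqType) (S : seq T)
    (phi : T -> 'Hom(V, K^o)) (ev : T -> V) :
  uniq S -> {in S &, forall s t, phi s (ev t) = (s == t)%:R} -> free (map ev S).
Proof.
move=> S_uniq dual; have [->|[t0 _]] : S = [::] \/ exists t0, t0 \in S.
- by case: (S) => [|t0 S0]; [left | right; exists t0; apply: mem_head].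
- by rewrite nil_free.
apply/(@freeP _ _ _ (in_tuple (map ev S))) => k k0 i.
have lt_S (j : 'I_(size (map ev S))) : (j < size S)%N by rewrite -(size_map ev).
have := congr1 (phi (nth t0 S i)) k0.
rewrite linear0 linear_sum (bigD1 i) //= big1 => [|j ne_ji].
  rewrite addr0 linearZ /= (nth_map t0) // dual ?mem_nth // eqxx.
  by move/eqP; rewrite mulf_eq0 oner_eq0 orbF => /eqP.
rewrite linearZ /= (nth_map t0) // dual ?mem_nth // nth_uniq // val_eqE.
by rewrite eq_sym (negbTE ne_ji) scaler0.
Qed.

Lemma memv_bigcap_seq (K : fieldType) (V : vectType K) (r : seq {vspace V}) x :
  (x \in (\bigcap_(H <- r) H)%VS) = all [pred H : {vspace V} | x \in H] r.
Proof. by elim: r => [|H r IHr]; rewrite ?big_nil ?memvf // big_cons memv_cap IHr. Qed.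

Section Evaluation.
Variables (K : fieldType) (T : finType).

Definition eval_at (t : T) (x : {ffun T -> K^o}) : K^o := x t.

Fact eval_at_is_linear t : linear (eval_at t).
Proof. by move=> a x y; rewrite /eval_at !ffunE. Qed.

HB.instance Definition _ t :=
  GRing.isLinear.Build K {ffun T -> K^o} K^o *:%R (eval_at t) (eval_at_is_linear t).

Lemma mem_graphic_arrangement (G : sgraph T) (H : {vspace {ffun T -> K^o}}) :
  H \in graphic_arrangement K G <->
  exists u v, G u v /\ H = lker (linfun (coord_diff (K := K) u v)).
Proof.
split=> [/imfsetP[[u v] /= Guv ->]|[u [v [Guv ->]]]]; first by exists u, v.
by apply/imfsetP; exists (u, v).
Qed.

Lemma memv_lker_coord_diff u v (x : {ffun T -> K^o}) :
  (x \in lker (linfun (coord_diff (K := K) u v))) = (x u == x v).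
Proof. by rewrite memv_ker lfunE /= subr_eq0. Qed.

End Evaluation.

(** * The flag of flats and the restrictions to it *)

Section Flats.
Variables (K : fieldType) (l : nat) (m : 'I_l.+2 -> 'I_l.+2 -> nat).
Hypothesis m_cycle : forall i j : 'I_l.+2, (i < j)%N ->
  [set i; j]%SET \notin [set [set k; ordS k]%SET | k : 'I_l.+2]%SET -> m i j = 0%N.
Notation T := ('I_l.+2 + new_vertex m)%type.
Notation V := {ffun T -> K^o}.
Notation S d := (take d (vertex_order m)).
Notation rho := (@contr l m).
Notation A := (graphic_arrangement K (Q m)).

Definition fibre d (t : T) : V := [ffun v => (rho d v == t)%:R].
Definition flat d : {vspace V} := <<map (fibre d) (S d)>>%VS.

Lemma contr_idem d v : (0 < d)%N -> rho d (rho d v) = rho d v.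
Proof. by move=> d_gt0; rewrite contr_id // contr_mem. Qed.

Lemma eval_fibre d : {in S d &, forall s t, fibre d t s = (s == t)%:R}.
Proof. by move=> s t sS tS; rewrite ffunE contr_id. Qed.

Lemma fibre_expand d (x : V) : (0 < d)%N -> (forall v, x v = x (rho d v)) ->
  x = \sum_(t <- S d) x t *: fibre d t.
Proof.
move=> d_gt0 x_rho; apply/ffunP=> v; rewrite sum_ffunE x_rho.
rewrite (bigD1_seq (rho d v)) ?contr_mem ?take_uniq ?vertex_order_uniq //=.
rewrite !ffunE eqxx big1 ?addr0 => [|t ne_t]; first by rewrite /GRing.scale /= mulr1.
by rewrite !ffunE eq_sym (negbTE ne_t) scaler0.
Qed.

Lemma mem_flat d (x : V) : (0 < d)%N ->
  reflect (forall v, x v = x (rho d v)) (x \in flat d).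
Proof.
move=> d_gt0; apply: (iffP idP) => [|x_rho].
  move/(@coord_span _ _ _ (in_tuple _)) => -> v; rewrite !sum_ffunE.
  apply: eq_bigr => i _; rewrite !ffunE; congr (_ *: _).
  have lt_i : (i < size (S d))%N by rewrite -(size_map (fibre d)).
  by rewrite (nth_map (inl ord0)) // !ffunE contr_idem.
rewrite (fibre_expand d_gt0 x_rho) big_seq; apply: memv_suml => t tS.
by apply/memvZ/memv_span/map_f.
Qed.

Lemma fibre_mem d t : (0 < d)%N -> t \in S d -> fibre d t \in flat d.
Proof. by move=> d_gt0 tS; apply/mem_flat => // v; rewrite !ffunE contr_idem. Qed.

Lemma dim_flat d : (d <= #|{: T}|)%N -> \dim (flat d) = d.
Proof.
move=> le_d; have: free (map (fibre d) (S d)).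
  apply: (dual_free (phi := fun t => linfun (eval_at (K := K) t))).
    exact/take_uniq/vertex_order_uniq.
  by move=> s t sS tS; rewrite lfunE /= /eval_at eval_fibre.
by move/eqnP; rewrite size_map size_take_min size_vertex_order (minn_idPl le_d).
Qed.

(** The fibres of the contraction are connected: clique vertices are pairwise adjacent, and a
    removed triangle vertex goes where its first neighbour goes. *)
Lemma flat_connected d (x : V) : (0 < d)%N ->
  (forall u v, Qedge u v -> rho d u = rho d v -> x u = x v) ->
  forall v, x v = x (rho d v).
Proof.
move=> d_gt0 x_edge.
have x_core i : x (inl i) = x (rho d (inl i)).
  have [j ej] := contr_core m d i; have [eij|ne_ij] := eqVneq i j.
    by rewrite ej eij.
  by apply: x_edge; rewrite ?contr_idem // ej.
case=> // w; have [wS|wS] := boolP (inr w \in S d); first by rewrite contr_id.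
(* If the first neighbour is removed, both follow the same colour; if it survives, it is 0, 1 or 2
   and represents its own colour. *)
have eq_rho : rho d (inr w) = rho d (inl (tag w).1).
  rewrite {1}/contr (negbTE wS) /contr /base.
  case: (boolP (inl (tag w).1 \in S d)) => // aS.
  by rewrite (color_id (tri_notin_core wS aS)) aS.
rewrite eq_rho -x_core; apply: x_edge => //=.
by rewrite eqxx.
Qed.

Lemma flat_in_lattice d : (0 < d)%N -> in_lattice A (flat d).
Proof.
move=> d_gt0.
(* Take all hyperplanes containing the flat: they are the equations of the contracted edges. *)
exists [fset H in A | (flat d <= H)%VS]%fset; first exact: fset_sub.
apply/vspaceP=> x; rewrite memv_bigcap_seq; apply/idP/allP => [xX H|x_B].
  by rewrite !inE => /andP[_ /subvP]; apply.
apply/(mem_flat _ d_gt0)/flat_connected => // u v uv eq_uv; apply/eqP.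
rewrite -memv_lker_coord_diff; apply: x_B; rewrite !inE; apply/andP; split.
  by apply/mem_graphic_arrangement; exists u, v.
apply/subvP=> z /(mem_flat _ d_gt0) z_rho.
by rewrite memv_lker_coord_diff z_rho (z_rho v) eq_uv.
Qed.

Lemma flat_full d : (#|{: T}| <= d)%N -> flat d = {:V}%VS.
Proof.
move=> le_d; have d_gt0 : (0 < d)%N.
  by apply: leq_trans le_d; apply/card_gt0P; exists (inl ord0).
apply/vspaceP=> x; rewrite memvf; apply/mem_flat => // v.
by rewrite contr_id // take_oversize ?size_vertex_order ?mem_vertex_order.
Qed.

Lemma flatS d : (0 < d)%N -> (flat d <= flat d.+1)%VS.
Proof.
move=> d_gt0; apply/subvP=> x /(mem_flat _ d_gt0) x_rho; apply/mem_flat=> // v.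
by rewrite x_rho [RHS]x_rho contr_contr.
Qed.

Lemma mem_restriction_flat d H : (0 < d)%N ->
  let phi t := (linfun (eval_at (K := K) t) \o
                linfun (vsval : subvs_of (flat d) -> V))%VF in
  H \in restriction A (flat d) <-> exists u v : T,
    [/\ Qedge u v, rho d u != rho d v & H = lker (phi (rho d u) - phi (rho d v))].
Proof.
move=> d_gt0 phi.
have preimE u v : (linfun (vsval : subvs_of (flat d) -> V) @^-1:
    lker (linfun (coord_diff (K := K) u v)))%VS = lker (phi (rho d u) - phi (rho d v)).
  apply/vspaceP=> x; rewrite -memv_preim memv_lker_coord_diff.
  apply/idP/eqlfunP; rewrite /phi !comp_lfunE !lfunE /= /eval_at.
    by have /(mem_flat _ d_gt0) x_rho := subvsP x; move/eqP; rewrite x_rho [in RHS]x_rho.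
  by have /(mem_flat _ d_gt0) x_rho := subvsP x; rewrite -!x_rho => ->.
split=> [/imfsetP[H0 /andP[/mem_graphic_arrangement[u [v [uv eH0]]] not_sub] ->]|].
  exists u, v; split; rewrite ?eH0 ?preimE //.
  apply: contraNneq not_sub => eq_uv; apply/subvP=> x /(mem_flat _ d_gt0) x_rho.
  by rewrite eH0 memv_lker_coord_diff x_rho (x_rho v) eq_uv.
move=> [u [v [uv ne_uv ->]]]; rewrite -preimE; apply/imfsetP.
exists (lker (linfun (coord_diff (K := K) u v))) => //; apply/andP; split.
  by apply/mem_graphic_arrangement; exists u, v.
(* The indicator of the fibre of [u] lies in the flat but separates [u] from [v]. *)
apply/subvPn; exists (fibre d (rho d u)); first by rewrite fibre_mem ?contr_mem.
by rewrite memv_lker_coord_diff !ffunE eqxx [rho d v == _]eq_sym (negbTE ne_uv) oner_eq0.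
Qed.

Lemma restriction_flat_free d : (0 < d)%N ->
  free_with_exponents (restriction A (flat d)) (map (@deg l m) (S d)).
Proof.
move=> d_gt0 b b_basis.
apply: (basis_coeff_free m_cycle d_gt0 (ev := fun t => vsproj (flat d) (fibre d t)) _ _
  (fun H => mem_restriction_flat H d_gt0)) b_basis => [s t sS tS|x].
  by rewrite comp_lfunE !lfunE /= vsprojK ?fibre_mem // /eval_at eval_fibre.
apply/val_inj; rewrite /= linear_sum /=.
have /(mem_flat _ d_gt0) x_rho := subvsP x.
rewrite {1}(fibre_expand d_gt0 x_rho); apply: eq_big_seq => t tS.
by rewrite vsprojK ?fibre_mem // comp_lfunE !lfunE.
Qed.

(** The contraction that removes nothing, treated in [V] itself: [restriction_flat_free] would speak
    of the subspace type of the full flat. *)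
Lemma graphic_arrangement_free :
  free_with_exponents A (map (@deg l m) (vertex_order m)).
Proof.
set n := #|{: T}|; have n_gt0 : (0 < n)%N by apply/card_gt0P; exists (inl ord0).
have S_all : S n = vertex_order m by rewrite take_oversize ?size_vertex_order.
have rho_id v : rho n v = v by rewrite contr_id // S_all mem_vertex_order.
move=> b b_basis; rewrite -S_all.
apply: (basis_coeff_free m_cycle n_gt0 (phi := fun t => linfun (eval_at (K := K) t))
  (ev := fibre n) _ _ _ b_basis) => [s t sS tS|x|H].
- by rewrite lfunE /= /eval_at eval_fibre.
- rewrite {1}(@fibre_expand n x n_gt0) => [|v]; last by rewrite rho_id.
  by apply: eq_bigr => t _; rewrite lfunE.
have kerE u v : lker (linfun (coord_diff (K := K) u v)) =
    lker (linfun (eval_at (K := K) u) - linfun (eval_at (K := K) v)).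
  apply/vspaceP=> x; rewrite memv_lker_coord_diff memv_ker add_lfunE opp_lfunE.
  by rewrite !lfunE subr_eq0.
split=> [/mem_graphic_arrangement[u [v [uv ->]]]|[u [v [uv _ ->]]]].
  exists u, v; rewrite !rho_id; split; [by [] | | exact: kerE].
  by apply: contraTneq uv => ->; rewrite edge_irrefl.
by apply/mem_graphic_arrangement; exists u, v; rewrite kerE !rho_id.
Qed.

Lemma cycle_triangles_flag_accurate : flag_accurate A.
Proof.
have dimV : \dim {:V} = #|{: T}| by rewrite -(@flat_full #|{: T}|) ?dim_flat.
exists (map (@deg l m) (vertex_order m)), flat; split; split.
- by rewrite size_map size_vertex_order dimV.
- exact: deg_sorted.
- exact: graphic_arrangement_free.
- rewrite dimV => d /andP[d_gt0 le_d]; split; last 1 first.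
  (* The degrees do not depend on [d], so truncating the exponents is the same as truncating the
     vertex order. *)
  + by rewrite -map_take; apply: restriction_flat_free.
  + exact: flat_in_lattice.
  + exact: dim_flat.
- by move=> d /andP[d_gt0 _]; apply: flatS.
by rewrite flat_full // dimV.
Qed.

End Flats.

(* The vertices 1, ..., l are numbered from 0, and [ordS] is the cyclic
   successor k |-> k + 1 mod l. *)
Theorem theorem6p8 (K : fieldType) (l : nat) (m : 'I_l -> 'I_l -> nat)
    (hl : (2 <= l)%N)
    (hm : forall i j : 'I_l, (i < j)%N ->
       [set i; j]%SET \notin [set [set k; ordS k]%SET | k : 'I_l]%SET ->
       m i j = 0%N) :
  flag_accurate (graphic_arrangement K (Q m)).
Proof.
case: l m hl hm => [|[|l]] // m _ hm.
exact: cycle_triangles_flag_accurate.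
Qed.
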